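(* Let $N\ge 2$, let $J_1,\dots,J_N:\mathcal T^N\to\mathbb R$ be the payoffs of the pure stopping game and let $J_1^R,\dots,J_N^R:\mathcal R^N\to\mathbb R$ be the payoffs of its canonical independently randomized extension. Let $\iota:\mathcal T^N\to\mathcal R^N$ be the canonical embedding $\iota(\tau)^i_t=\mathbf 1_{\{\tau^i\le t\}}$. Then for every $\varepsilon\ge 0$ and every $\tau^\varepsilon\in\mathcal T^N$: $\tau^\varepsilon$ is an $\varepsilon$-Nash equilibrium of the pure game if and only if $\iota(\tau^\varepsilon)$ is an $\varepsilon$-Nash equilibrium of the randomized game.
   Context: Fix $N\ge 2$ and $[N]=\{1,\dots,N\}$. $(\Omega,\mathcal F,\mathbb F,\mathbb P)$ is a filtered probability space satisfying the usual conditions, where $\mathbb F=(\mathcal F_t)_{t\ge 0}$ is generated by a continuous exogenous state process $X=(X_t)_{t\ge0}$. $\mathcal T$ is the set of $\mathbb F$-stopping times $\tau:\Omega\to[0,\infty)$. Pure game. For each $i\in[N]$, $G_i:\Omega\times[0,\infty)^N\to\mathbb R$ is $\mathcal F\otimes\mathcal B([0,\infty)^N)$-measurable, with $G_i(\tau)(\omega):=G_i(\omega,\tau^1(\omega),\dots,\tau^N(\omega))$ and $\sup_{\tau\in\mathcal T^N}\mathbb E[|G_i(\tau)|]<\infty$. Put $J_i(\tau):=\mathbb E[G_i(\tau)]$. A profile $\tau^\varepsilon\in\mathcal T^N$ is an $\varepsilon$-Nash equilibrium of the pure game if $J_i(\tau^\varepsilon)\ge\sup_{\sigma^i\in\mathcal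 T}J_i(\sigma^i,\tau^{\varepsilon,-i})-\varepsilon$ for every $i$, where $(\sigma^i,\tau^{-i})$ denotes $\tau$ with its $i$-th component replaced by $\sigma^i$. Randomized game. $\mathcal R$ is the set of processes $p:[0,\infty)\times\Omega\to[0,1]$ that are $\mathbb F$-adapted, càdlàg, nondecreasing, with $p_{0-}=0$ and $p_\infty=\lim_{t\to\infty}p_t=1$. For $p\in\mathcal R^N$ and $u\in[0,1]^N$ let $\Theta^{i,p^i}(\omega,u_i):=\inf\{t\ge0:p^i_t(\omega)>u_i\}$ (the convention at $u_i=1$ is immaterial). Let $(\overline\Omega,\overline{\mathcal F},\overline{\mathbb P})=(\Omega\times[0,1]^N,\mathcal F\otimes\mathcal B([0,1]^N),\mathbb P\otimes\mathrm{Leb}^{\otimes N})$, with coordinate maps $U^1,\dots,U^N$ on $[0,1]^N$, and $\Theta^p:=(\Theta^{1,p^1}(\cdot,U^1),\dots,\Theta^{N,p^N}(\cdot,U^N))$. The randomized payoff is $J_i^R(p):=\overline{\mathbb E}[G_i(\Theta^p)]$, equivalently $J_i^R(p)=\int_{[0,1]^N}J_i(\Theta^{1,p^1}(\cdot,u_1),\dots,\Theta^{N,p^N}(\cdot,u_N))\,du$. A profile $p^\varepsilon\in\mathcal R^N$ is an $\varepsilon$-Nash equilibrium of the randomized game if $J_i^R(p^\varepsilon)\ge\sup_{q^i\in\mathcal R}J_i^R(q^i,p^{\varepsilon,-i})-\varepsilon$ for every $i$. *)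

(* Defs.v *)
From HB Require Import structures.
From mathcomp Require Import all_boot all_order all_algebra.
From mathcomp Require Import all_classical all_reals all_analysis.

Set Implicit Arguments.
Unset Strict Implicit.
Unset Printing Implicit Defensive.

Import Order.TTheory GRing.Theory Num.Theory.
Import numFieldNormedType.Exports.

Local Open Scope classical_set_scope.
Local Open Scope ring_scope.

(* Time is [0, +oo[ inside R: a filtration is indexed by R but only its values
   at nonnegative times are ever constrained or used. *)

Section filtrations.
Context {R : realType} {d : measure_display} {T : measurableType d}.

Definition filtration (F : R -> set (set T)) : Prop :=
  [/\ forall t : R, 0 <= t -> sigma_algebra [set: T] (F t),
      forall t : R, 0 <= t -> F t `<=` measurable &
      forall s t : R, 0 <= s -> s <= t -> F s `<=` F t].

(* The second clause makes (T, P) complete, since F 0 consists of measurable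
   sets. *)
Definition usual_conditions (P : probability T R) (F : R -> set (set T)) :
    Prop :=
  [/\ filtration F, P.-negligible `<=` F 0 &
      forall t : R, 0 <= t -> F t = \bigcap_(s in `]t, +oo[) F s].

Definition natural_filtration (E : topologicalType) (X : R -> T -> E) (t : R) :
    set (set T) :=
  <<s \bigcup_(s in `[0, t])
        preimage_set_system [set: T] (X s) <<s @open E >> >>.

Definition usual_augmentation (P : probability T R) (E : topologicalType)
    (X : R -> T -> E) (t : R) : set (set T) :=
  \bigcap_(s in `]t, +oo[)
    <<s natural_filtration X s `|` P.-negligible >>.

Definition continuous_process (E : topologicalType) (X : R -> T -> E) : Prop :=
  forall w, {within [set` `[0, +oo[ ], continuous (X ^~ w)}.

Definition stopping_times (F : R -> set (set T)) : set (T -> R) :=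
  [set tau | (forall w, 0 <= tau w) /\
             (forall t : R, 0 <= t -> F t [set w | tau w <= t])].

Definition adapted (F : R -> set (set T)) (p : R -> T -> R) : Prop :=
  forall t : R, 0 <= t -> forall B, measurable B -> F t (p t @^-1` B).

Definition cadlag (f : R -> R) : Prop :=
  right_continuous f /\ forall t, cvg (f s @[s --> t^'-]).

(* p_{0-} = 0 is encoded by extending p by 0 to negative times; p_0 itself is
   unconstrained in [0, 1]. *)
Record randomized_strategy (F : R -> set (set T)) (p : R -> T -> R) : Prop := {
  rs_range : forall (t : R) w, 0 <= p t w <= 1 ;
  rs_adapted : adapted F p ;
  rs_cadlag : forall w, cadlag (p ^~ w) ;
  rs_nondecreasing : forall w, {homo p ^~ w : s t / s <= t} ;
  rs_0minus : forall (t : R) w, t < 0 -> p t w = 0 ;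
  rs_infty : forall w, p t w @[t --> +oo] --> (1 : R) }.

Definition randomized_strategies (F : R -> set (set T)) : set (R -> T -> R) :=
  [set p | randomized_strategy F p].

(* inf set0 = 0, which fixes the value at u = 1. *)
Definition Theta (p : R -> T -> R) (w : T) (u : R) : R :=
  inf [set t | 0 <= t /\ u < p t w].

Definition iota_embed (N : nat) (tau : 'I_N -> T -> R) : 'I_N -> R -> T -> R :=
  fun i t w => \1_[set v | tau i v <= t] w.

End filtrations.

Section lebesgue_cube.
Context {R : realType}.
Local Open Scope ereal_scope.

Definition leb01 : set (measurableTypeR R) -> \bar R :=
  mrestr lebesgue_measure (measurable_itv `[0%R, 1%R]).

HB.instance Definition _ := Measure.on leb01.

Let leb01_setT : leb01 setT = 1.
Proof.
by rewrite /leb01 /mrestr setTI lebesgue_measure_itv/= lte_fin ltr01 -EFinD subr0.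
Qed.

HB.instance Definition _ := Measure_isProbability.Build _ _ _ leb01 leb01_setT.

Definition tuple_cons n (x : measurableTypeR R * n.-tuple (measurableTypeR R)) :
  n.+1.-tuple (measurableTypeR R) := [tuple of x.1 :: x.2].

Lemma measurable_tuple_cons n : measurable_fun setT (@tuple_cons n).
Proof. exact: measurable_cons. Qed.

HB.instance Definition _ n :=
  isMeasurableFun.Build _ _ _ _ (@tuple_cons n) (@measurable_tuple_cons n).

(* Leb^{\otimes n} on [0,1]^n, as a probability on R^n concentrated on the
   cube. *)
Fixpoint leb_cube (n : nat) :
    probability (n.-tuple (measurableTypeR R)) R :=
  match n return probability (n.-tuple (measurableTypeR R)) R with
  | 0 => dirac [tuple]
  | m.+1 => distribution (leb01 \x leb_cube m) (@tuple_cons m)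
  end.

Lemma leb_cubeE (n : nat) (A : 'I_n -> set (measurableTypeR R)) :
  (forall i, measurable (A i)) ->
  leb_cube n [set u | forall i, A i (tnth u i)] = \prod_(i < n) leb01 (A i).
Proof.
elim: n A => [|n IH] A mA.
  by rewrite big_ord0 /= diracE mem_set// => -[].
rewrite big_ord_recl -(IH (A \o lift ord0)) => [|i]; last exact: mA.
rewrite /= /distribution /pushforward.
rewrite [X in (leb01 \x leb_cube n) X](_ : _ =
    A ord0 `*` [set u | forall i, A (lift ord0 i) (tnth u i)]).
  rewrite product_measure1E//.
  rewrite [X in measurable X](_ : _ =
      \bigcap_(i in [set: 'I_n]) (@tnth n _ ^~ i @^-1` A (lift ord0 i))).
    apply: fin_bigcap_measurable; first exact: finite_finset.
    move=> i _; rewrite -[X in measurable X]setTI; apply: measurable_tnth => //.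
  by apply/seteqP; split => [u h i _|u h i]; [exact: h|exact: (h i)].
apply/seteqP; split => -[x u] /=.
  move=> h; split; first exact: (h ord0).
  by move=> i; have := h (lift ord0 i); rewrite tnthS.
move=> [Ax Au] i; case: (unliftP ord0 i) => [j ->|->//].
by rewrite tnthS.
Qed.

End lebesgue_cube.

Section games.
Context {R : realType} {d : measure_display} {T : measurableType d}.
Context (N : nat).
Local Open Scope ereal_scope.

Definition nonneg_times : set (N.-tuple R) :=
  [set t | forall i, (0 <= tnth t i)%R].

Definition deviate (S : Type) (s : 'I_N -> S) (i : 'I_N) (a : S) : 'I_N -> S :=
  fun j => if j == i then a else s j.

Definition is_nash (S : Type) (A : set S) (J : 'I_N -> ('I_N -> S) -> \bar R)
    (eps : R) (s : 'I_N -> S) : Prop :=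
  (forall i, A (s i)) /\
  forall i, J i s >= ereal_sup [set J i (deviate s i a) | a in A] - eps%:E.

Definition pure_outcome (g : T -> N.-tuple R -> R) (tau : 'I_N -> T -> R) :
    T -> R :=
  fun w => g w [tuple tau j w | j < N].

Definition randomized_outcome (g : T -> N.-tuple R -> R)
    (p : 'I_N -> R -> T -> R) : T * N.-tuple (measurableTypeR R) -> R :=
  fun z => g z.1 [tuple Theta (p j) z.1 (tnth z.2 j) | j < N].

(* Payoffs are \bar R-valued only because the library's expectation is. *)
Definition pure_payoff (P : probability T R) (G : 'I_N -> T -> N.-tuple R -> R)
    (i : 'I_N) (tau : 'I_N -> T -> R) : \bar R :=
  'E_P[pure_outcome (G i) tau].

Definition randomized_payoff (P : probability T R)
    (G : 'I_N -> T -> N.-tuple R -> R)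
    (i : 'I_N) (p : 'I_N -> R -> T -> R) : \bar R :=
  'E_(P \x leb_cube N)[randomized_outcome (G i) p].

End games.

(* Main.v *)
(* Fix an opponent profile iota(tau^{-i}) and a randomized deviation q.  For
   almost every u the random times of the opponents are tau^{-i}, whatever u is,
   and the time Theta^q(., u_i) of the deviator is an ordinary stopping time, by
   right-continuity of the filtration.  By Fubini the randomized payoff of the
   deviation is therefore an average over u of pure payoffs of deviations of
   player i, so it does not exceed their supremum.  Conversely every pure
   deviation is embedded with the same payoff.  The suprema defining the two
   equilibrium notions hence coincide, and so do the payoffs of the profile. *)
Require Import Defs.
From HB Require Import structures.
From mathcomp Require Import all_boot all_order all_algebra.
From mathcomp Require Import all_classical all_reals all_analysis.
From mathcomp Require Import measurable_realfun.

Set Implicit Arguments.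
Unset Strict Implicit.
Unset Printing Implicit Defensive.

Import Order.TTheory GRing.Theory Num.Theory.
Import numFieldNormedType.Exports.

Local Open Scope classical_set_scope.
Local Open Scope ring_scope.

(** * Randomized strategies and their threshold times *)

Section randomized_stopping.
Context {R : realType} {d : measure_display} {T : measurableType d}.
Implicit Types (F : R -> set (set T)) (p : R -> T -> R).

Lemma sigma_algebra_bigcapT (G : set (set T)) (A : (set T)^nat) :
  sigma_algebra [set: T] G -> (forall n, G (A n)) -> G (\bigcap_n A n).
Proof.
move=> [_ GC GU] GA; rewrite -(setCK (\bigcap_n _)) setC_bigcap -setTD.
by apply/GC/GU => n; rewrite -setTD; apply: GC.
Qed.

Lemma Theta_ge0 p w u : 0 <= Theta p w u.
Proof.
rewrite /Theta; set S := [set t | _].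
have [->|S0] := eqVneq S set0; first by rewrite inf0.
by apply: lb_le_inf => [|x []//]; exact/set0P.
Qed.

Lemma Theta_le p w u t : 0 <= t -> u < p t w -> Theta p w u <= t.
Proof. by move=> t0 ut; apply: ge_inf => //; exists 0 => x []. Qed.

(** Since the path tends to 1 and [u < 1], the set defining [Theta] is nonempty, so its infimum is
    approached by genuine elements and is not the default 0. *)
Lemma Theta_lt F p w u c : randomized_strategy F p -> u < 1 ->
  Theta p w u < c -> exists t, [/\ 0 <= t, t < c & u < p t w].
Proof.
move=> ps u1 /inf_lt[|t [t0 ut] tc]; last by exists t.
have /cvgr_gt/(_ _ u1) up := rs_infty ps w.
near (+oo : set_system R) => t; exists t; split; near: t; last exact: up.
exact: nbhs_pinfty_ge.
Unshelve. all: by end_near. Qed.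

Lemma Theta_ge1 F p w u : randomized_strategy F p -> 1 <= u ->
  Theta p w u = 0.
Proof.
move=> ps u1; rewrite /Theta [X in inf X](_ : _ = set0) ?inf0//.
rewrite -subset0 => t [_]; apply/negP; rewrite -leNgt (le_trans _ u1)//.
by have /andP[] := rs_range ps t w.
Qed.

(** The path may reach [u] at time [t] and exceed it only afterwards, so [Theta <= t] is an event
    about the times just after [t]. It lies in [F s] for every [s > t], and right-continuity of the
    filtration returns it to [F t]. *)
Lemma Theta_stopping (P : probability T R) F p u :
  usual_conditions P F -> randomized_strategy F p -> u < 1 ->
  stopping_times F ((Theta p) ^~ u).
Proof.
move=> [[Fsigma _ Fmono] _ Fright] ps u1; split=> [w|t t0].
  exact: Theta_ge0.
rewrite Fright// => s; rewrite /= in_itv/= andbT => ts.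
(* These times tend to [t] from above, and the cap at [s] keeps each event [u < p (r n)] in
   [F s]. *)
pose r n : R := Num.min s (t + n.+1%:R^-1).
have tr n : t < r n by rewrite lt_min ts ltrDl invr_gt0 ltr0n.
have r0 n : 0 <= r n by rewrite (le_trans t0)// ltW.
have s0 : 0 <= s by rewrite (le_trans t0)// ltW.
rewrite [X in F s X](_ : _ = \bigcap_n (p (r n) @^-1` `]u, +oo[)).
  apply: sigma_algebra_bigcapT; first exact: Fsigma.
  move=> n; apply: (Fmono (r n)) => //; first by rewrite /r ge_min lexx.
  by apply: (rs_adapted ps).
apply/seteqP; split=> w /=.
- move=> Thet n _ /=; rewrite in_itv/= andbT.
  have [t' [_ t'r /lt_le_trans]] := Theta_lt ps u1 (le_lt_trans Thet (tr n)).
  by apply; apply: (rs_nondecreasing ps); exact: ltW.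
- move=> H; rewrite leNgt; apply/negP => /ltr_add_invr[k]; apply/negP.
  rewrite -leNgt; have := H k I; rewrite /= in_itv/= andbT => /Theta_le.
  by move=> /(_ (r0 k))/le_trans; apply; rewrite ge_min lexx orbT.
Qed.

(** Fubini needs measurability jointly in the state and the threshold, not only for each fixed [u].
    As paths are monotone, a sequence of times approaching [c] from below decides whether [Theta] is
    below [c]. *)
Lemma measurable_Theta F p : filtration F -> randomized_strategy F p ->
  measurable_fun [set: T * R] (fun z => Theta p z.1 z.2).
Proof.
move=> [_ Fmeas _] ps _.
apply: (measurability _ (RGenInftyO.measurableE R)) => // _ [_ [c ->] <-].
rewrite setTI; have [c0|c0] := leP c 0.
  rewrite [X in measurable X](_ : _ = set0)// -subset0 => -[w u] /=.
  by rewrite in_itv/= => /lt_le_trans/(_ c0); rewrite ltNge Theta_ge0.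
(* Clamping at 0 keeps these times in the range where adaptedness applies. *)
pose r n : R := Num.max 0 (c - n.+1%:R^-1).
have r0 n : 0 <= r n by rewrite le_max lexx.
have rc n : r n < c by rewrite gt_max c0 ltrBlDr ltrDl invr_gt0 ltr0n.
(* Thresholds [u >= 1] enter separately: there the default [inf set0 = 0] is already below [c]. *)
rewrite [X in measurable X](_ : _ = (snd @^-1` `[1, +oo[) `|`
    \bigcup_n [set z : T * R | z.2 < p (r n) z.1]).
  apply: measurableU.
    rewrite -[X in measurable X]setTI.
    exact: (@measurable_snd _ _ T R measurableT `[1, +oo[%classic).
  apply: bigcupT_measurable => n.
  rewrite -[X in measurable X]setTI.
  apply: (@measurable_fun_ltr _ _ _ setT snd (p (r n) \o fst) _ _
    measurableT [set true]) => //.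
  apply: measurableT_comp; last exact: measurable_fst.
  move=> _ B mB; rewrite setTI.
  by apply: (Fmeas (r n)) => //; apply: (rs_adapted ps).
apply/seteqP; split=> -[w u] /=; rewrite in_itv/=.
- have [u1 _|u1 uc] := leP 1 u; first by left; rewrite in_itv/= u1.
  right; have [t [t0 tc ut]] := Theta_lt ps u1 uc.
  have [k tk] := ltr_add_invr tc; exists k => //=.
  rewrite (lt_le_trans ut)//; apply: (rs_nondecreasing ps).
  by rewrite le_max lerBrDr (ltW tk) orbT.
- move=> [|[n _] /= urn]; last exact: le_lt_trans (Theta_le (r0 n) urn) (rc n).
  by rewrite in_itv/= andbT => /(Theta_ge1 w ps) ->.
Qed.

(** A path equal to 0 before [tau w] and to 1 from then on exceeds any [u] in [[0, 1)] exactly from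
    [tau w] onwards. Embedded pure strategies thus ignore their threshold. *)
Lemma Theta_indic (tau : T -> R) w u : 0 <= tau w -> 0 <= u < 1 ->
  Theta (fun t v => \1_[set v' | tau v' <= t] v) w u = tau w.
Proof.
move=> tau0 /andP[u0 u1]; rewrite /Theta.
rewrite [X in inf X](_ : _ = `[tau w, +oo[%classic).
  by rewrite inf_itv.
apply/seteqP; split=> t /=; rewrite in_itv/= andbT indicE.
- move=> [_]; case: (boolP (_ \in _)) => [|_]; first by rewrite inE.
  by rewrite ltNge u0.
- by move=> taut; rewrite mem_set//; split=> //; exact: le_trans taut.
Qed.

(** Each path is a unit jump at [tau w]. The value 1 is taken at the jump itself, which gives
    right-continuity, and [tau w] is finite, which gives the limit 1. *)
Lemma stopping_time_randomized F (tau : T -> R) :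
  filtration F -> stopping_times F tau ->
  randomized_strategy F (fun t v => \1_[set v' | tau v' <= t] v).
Proof.
move=> [Fsigma _ _] [tau0 Ftau].
have tau_le t w : tau w <= t -> \1_[set v | tau v <= t] w = 1 :> R.
  by move=> h; rewrite indicE mem_set.
have tau_gt t w : t < tau w -> \1_[set v | tau v <= t] w = 0 :> R.
  by move=> h; rewrite indicE memNset//=; apply/negP; rewrite -ltNge.
split.
- by move=> t w; rewrite indicE; case: (_ \in _); rewrite lexx ler01.
- move=> t t0 B _; have [F0 FC FU] := Fsigma _ t0.
  have FT : F t setT by have := FC _ F0; rewrite setD0.
  have Fc : F t (~` [set v | tau v <= t]).
    by rewrite -setTD; exact: FC (Ftau _ t0).
  by rewrite preimage_indic; do 2 case: ifP => _ //; exact: Ftau.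
- move=> w; split=> t.
    have [taut|taut] := leP (tau w) t.
      rewrite (tau_le t w taut); apply: cvg_near_cst; near=> s.
      by apply: tau_le; rewrite (le_trans taut).
    rewrite (tau_gt t w taut); apply: cvg_near_cst; near=> s.
    by apply: tau_gt.
  have [taut|taut] := ltP (tau w) t.
    apply/cvg_ex; exists (1 : R); apply: cvg_near_cst; near=> s.
    by apply: tau_le; near: s; exact: nbhs_left_ge.
  apply/cvg_ex; exists (0 : R); apply: cvg_near_cst; near=> s.
  by apply: tau_gt; rewrite (lt_le_trans _ taut).
- move=> w s t st; have [taus|taus] := leP (tau w) s.
    by rewrite !tau_le// (le_trans taus).
  by rewrite tau_gt// indicE.
- by move=> t w t0; apply: tau_gt; exact: lt_le_trans (tau0 w).
- move=> w; apply: cvg_near_cst; near=> t; apply: tau_le; near: t.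
  by apply: nbhs_pinfty_ge; rewrite num_real.
Unshelve. all: by end_near. Qed.

End randomized_stopping.

(** * Full measure of the half-open cube *)

Section lebesgue_cube.
Context {R : realType} {n : nat}.

(* The faces u_i = 1 are excluded: there Theta is inf set0 = 0. *)
Definition half_open_cube : set (n.-tuple (measurableTypeR R)) :=
  [set u | forall i, (0 <= (tnth u i : R) < 1)%R].

Lemma measurable_half_open_cube : measurable half_open_cube.
Proof.
rewrite [X in measurable X](_ : _ =
    \bigcap_(i in [set: 'I_n]) ((@tnth n _) ^~ i @^-1` `[0%R, 1%R[%classic)).
  apply: fin_bigcap_measurable; first exact: finite_finset.
  by move=> i _; rewrite -[X in measurable X]setTI; apply: measurable_tnth.
apply/seteqP; split=> u /= h i.
  by move=> _; rewrite /= in_itv/=; exact: h.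
by have := h i I; rewrite /= in_itv.
Qed.

Lemma leb_cube_half_open : leb_cube n half_open_cube = 1%E.
Proof.
rewrite [X in leb_cube n X](_ : _ =
    [set u | forall i, `[0%R, 1%R[%classic (tnth u i)]).
  rewrite (@leb_cubeE R n (fun=> `[0%R, 1%R[%classic)); last first.
    by move=> i; exact: measurable_itv.
  rewrite big1// => i _; rewrite /leb01 /mrestr setIidl.
    by rewrite lebesgue_measure_itv/= lte_fin ltr01 sube0.
  by apply: subset_itvl; rewrite bnd_simp.
by apply/seteqP; split=> u /= h i; have := h i; rewrite /= in_itv.
Qed.

Lemma leb_cube_half_openC : leb_cube n (~` half_open_cube) = 0%E.
Proof.
rewrite probability_setC; last exact: measurable_half_open_cube.
by rewrite leb_cube_half_open subee.
Qed.

Lemma integral_half_open_cube_cst (r : \bar R) :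
  (\int[leb_cube n]_(u in half_open_cube) cst r u = r)%E.
Proof.
rewrite integral_cst; last exact: measurable_half_open_cube.
by rewrite [X in (_ * X)%E]leb_cube_half_open mule1.
Qed.

End lebesgue_cube.

(** * Integrability of partial integrals *)

Section fubini.
Context d1 d2 (T1 : measurableType d1) (T2 : measurableType d2) (R : realType).
Variables (m1 : {sigma_finite_measure set T1 -> \bar R})
  (m2 : {sigma_finite_measure set T2 -> \bar R}).
Local Open Scope ereal_scope.

(** The absolute value of a partial integral is at most the partial integral of the absolute value,
    whose total is finite by Tonelli. For payoffs this allows null sets of thresholds to be dropped
    and averages to be compared. *)
Lemma integrable_fubini_G (f : T1 * T2 -> \bar R) :
  (m1 \x m2).-integrable setT f -> m2.-integrable setT (fubini_G m1 f).
Proof.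
move=> fi; have mf := measurable_int _ fi; have mG := measurable_fubini_G fi.
apply/integrableP; split=> //.
have /(integrable21ltyP _ _ mf) := fi; apply: le_lt_trans.
apply: ge0_le_integral => //.
- exact: measurableT_comp.
- apply: (@measurable_fun_fubini_tonelli_G _ _ _ _ _ m1 (abse \o f)) => [|z].
    exact: measurableT_comp.
  exact: abse_ge0.
- move=> y _; apply: le_abse_integral => //.
  exact: (measurableT_comp mf (measurable_pair2 y)).
Qed.

End fubini.

(** * Randomized payoffs as averages of pure payoffs *)

Section payoffs.
Context {R : realType} {d : measure_display} {T : measurableType d}.
Context (P : probability T R) (F : R -> set (set T)) (N : nat).
Hypothesis F_usual : usual_conditions P F.
Local Open Scope ereal_scope.

(** With [u] frozen, the pure outcome of this profile is, by mere unfolding, the section at [u] of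
    [randomized_outcome]. *)
Definition threshold_times (p : 'I_N -> R -> T -> R)
    (u : N.-tuple (measurableTypeR R)) : 'I_N -> T -> R :=
  fun j w => Theta (p j) w (tnth u j).

Lemma measurable_nonneg_times : measurable (@nonneg_times R N).
Proof.
rewrite [X in measurable X](_ : _ =
    \bigcap_(i in [set: 'I_N]) ((@tnth N R) ^~ i @^-1` `[0%R, +oo[%classic)).
  apply: fin_bigcap_measurable; first exact: finite_finset.
  by move=> i _; rewrite -[X in measurable X]setTI; apply: measurable_tnth.
apply/seteqP; split=> u /= h i.
  by move=> _; rewrite /= in_itv/= andbT; exact: h.
by have := h i I; rewrite /= in_itv/= andbT.
Qed.

Variable g : T -> N.-tuple R -> R.
Hypothesis mg : measurable_fun ([set: T] `*` @nonneg_times R N)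
  (fun z : T * N.-tuple R => g z.1 z.2).

(** As [g] is assumed measurable only at nonnegative times, the composition relies on [Theta] being
    nonnegative at every [u], even off the cube. *)
Lemma measurable_randomized_outcome (p : 'I_N -> R -> T -> R) :
  (forall j, randomized_strategy F (p j)) ->
  measurable_fun setT (randomized_outcome g p).
Proof.
move=> ps; have [Ffil _ _] := F_usual.
apply: (@measurable_comp _ _ _ _ _ _ ([set: T] `*` @nonneg_times R N)
  (fun z : T * N.-tuple R => g z.1 z.2) setT
  (fun z => (z.1, [tuple Theta (p j) z.1 (tnth z.2 j) | j < N]))) => //.
- by apply: measurableX => //; exact: measurable_nonneg_times.
- by move=> _ [z _ <-]; split=> // j; rewrite /= tnth_mktuple; exact: Theta_ge0.
- apply/measurable_fun_pairP; split; first exact: measurable_fst.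
  apply/measurable_fun_tnthP => j.
  rewrite [X in measurable_fun _ X](_ : _ = (fun z => Theta (p j) z.1 z.2) \o
      (fun z : T * N.-tuple (measurableTypeR R) => (z.1, tnth z.2 j))).
    apply: measurableT_comp; first exact: measurable_Theta Ffil (ps j).
    apply/measurable_fun_pairP; split; first exact: measurable_fst.
    apply: (measurableT_comp (f := (@tnth N (measurableTypeR R)) ^~ j)).
      exact: measurable_tnth.
    exact: measurable_snd.
  by apply/funext => z /=; rewrite tnth_mktuple.
Qed.

Lemma threshold_times_stopping (p : 'I_N -> R -> T -> R) u :
  (forall j, randomized_strategy F (p j)) -> half_open_cube u ->
  forall j, stopping_times F (threshold_times p u j).
Proof.
move=> ps cu j; have /andP[_ u1] := cu j.
exact: (Theta_stopping F_usual (ps j) u1).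
Qed.

Variable C : R.
Hypothesis gC : forall tau : 'I_N -> T -> R,
  (forall j, stopping_times F (tau j)) ->
  'E_P[fun w => `|pure_outcome g tau w|%R] <= C%:E.

(** By Tonelli it suffices to integrate the absolute moments of the sections over the thresholds. On
    the half-open cube each section is a pure outcome, so the moment is at most [C] uniformly in
    [u]; the rest is null. *)
Lemma integrable_randomized_outcome (p : 'I_N -> R -> T -> R) :
  (forall j, randomized_strategy F (p j)) ->
  (P \x leb_cube N).-integrable setT (EFin \o randomized_outcome g p).
Proof.
move=> ps; have mo := measurable_randomized_outcome ps.
apply/integrable21ltyP; first exact/measurable_EFinP.
rewrite (@ge0_negligible_integral _ _ _ _ _ (~` half_open_cube)) //.
- rewrite setTD setCK.
  apply: (@le_lt_trans _ _ (\int[leb_cube N]_(u in half_open_cube) cst C%:E u)).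
  + apply: ge0_le_integral => //.
    * exact: measurable_half_open_cube.
    * by move=> u _; exact: integral_ge0.
    * apply: measurable_funTS.
      apply: (@measurable_fun_fubini_tonelli_G _ _ _ _ _ P
        (fun z => `|(randomized_outcome g p z)%:E|)) => //.
      by apply: measurableT_comp => //; exact/measurable_EFinP.
    * move=> u cu; have := gC (threshold_times_stopping ps cu).
      by rewrite expectation.unlock.
  + by rewrite integral_half_open_cube_cst ltry.
- by apply: measurableC; exact: measurable_half_open_cube.
- apply: (@measurable_fun_fubini_tonelli_G _ _ _ _ _ P
    (fun z => `|(randomized_outcome g p z)%:E|)) => //.
  by apply: measurableT_comp => //; exact/measurable_EFinP.
- by move=> u _; exact: integral_ge0.
- exact: leb_cube_half_openC.
Qed.

Lemma randomized_payoff_threshold (p : 'I_N -> R -> T -> R) :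
  (forall j, randomized_strategy F (p j)) ->
  'E_(P \x leb_cube N)[randomized_outcome g p] =
  \int[leb_cube N]_(u in half_open_cube)
    'E_P[pure_outcome g (threshold_times p u)].
Proof.
move=> ps; have io := integrable_randomized_outcome ps.
rewrite expectation.unlock -(integral21_prod_meas1 io).
rewrite (@negligible_integral _ _ _ _ _ (~` half_open_cube)) ?setTD ?setCK//.
- by apply: measurableC; exact: measurable_half_open_cube.
- exact: integrable_fubini_G.
- exact: leb_cube_half_openC.
Qed.

Lemma randomized_payoff_fin_num (p : 'I_N -> R -> T -> R) :
  (forall j, randomized_strategy F (p j)) ->
  'E_(P \x leb_cube N)[randomized_outcome g p] \is a fin_num.
Proof.
move=> ps; rewrite expectation.unlock; apply: integrable_fin_num => //.
exact: integrable_randomized_outcome.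
Qed.

Lemma randomized_payoff_le (p : 'I_N -> R -> T -> R) (S : \bar R) :
  (forall j, randomized_strategy F (p j)) -> -oo < S ->
  (forall u, half_open_cube u ->
    'E_P[pure_outcome g (threshold_times p u)] <= S) ->
  'E_(P \x leb_cube N)[randomized_outcome g p] <= S.
Proof.
(* Monotonicity of the integral is used with an integrable constant, so only a finite bound is
   integrated; [+oo] is trivial. *)
move=> ps; case: S => [r||]//; last by rewrite leey.
move=> _ pr; rewrite randomized_payoff_threshold//.
have mcube := @measurable_half_open_cube R N.
rewrite -[leRHS](integral_half_open_cube_cst (n := N)).
apply: le_integral => //.
- rewrite expectation.unlock; have io := integrable_randomized_outcome ps.
  exact: (integrableS measurableT mcube _ (integrable_fubini_G io)).
- exact: finite_measure_integrable_cst.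
- by move=> u; rewrite inE; exact: pr.
Qed.

(** On the half-open cube the threshold times are [tau] itself, so a constant is averaged. *)
Lemma randomized_payoff_iota_embed (tau : 'I_N -> T -> R) :
  (forall j, stopping_times F (tau j)) ->
  'E_(P \x leb_cube N)[randomized_outcome g (iota_embed tau)] =
  'E_P[pure_outcome g tau].
Proof.
move=> taus; have [Ffil _ _] := F_usual.
have ps j : randomized_strategy F (iota_embed tau j).
  exact: stopping_time_randomized.
rewrite randomized_payoff_threshold//.
rewrite (eq_integral (cst 'E_P[pure_outcome g tau])).
  exact: integral_half_open_cube_cst.
move=> u; rewrite inE => cu; congr ('E_P[pure_outcome g _]).
apply/funext => j; apply/funext => w; apply: Theta_indic; last exact: cu.
by have [] := taus j.
Qed.

End payoffs.

(** * Equality of the suprema over pure and randomized deviations *)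

Theorem proposition2p5 (R : realType) (d : measure_display)
    (T : measurableType d) (P : probability T R)
    (E : topologicalType) (X : R -> T -> E) (F : R -> set (set T))
    (X_continuous : continuous_process X)
    (F_usual : usual_conditions P F)
    (F_generated : forall t : R, 0 <= t -> F t = usual_augmentation P X t)
    (N : nat) (N_ge2 : (2 <= N)%N)
    (G : 'I_N -> T -> N.-tuple R -> R)
    (G_measurable : forall i,
      measurable_fun ([set: T] `*` @nonneg_times R N)
                     (fun z : T * N.-tuple R => G i z.1 z.2))
    (G_L1_bounded : forall i,
      (ereal_sup [set 'E_P[fun w => `|pure_outcome (G i) tau w|%R]
                 | tau in [set tau | forall j, stopping_times F (tau j)]]
       < +oo)%E)
    (eps : R) (eps_ge0 : 0 <= eps)
    (tau : 'I_N -> T -> R) (tau_stopping : forall i, stopping_times F (tau i)) :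
  is_nash (stopping_times F) (pure_payoff P G) eps tau <->
  is_nash (randomized_strategies F) (randomized_payoff P G) eps
          (iota_embed tau).
Proof.
have [Ffil _ _] := F_usual.
have GC i : exists C : R, forall sigma : 'I_N -> T -> R,
    (forall j, stopping_times F (sigma j)) ->
    ('E_P[fun w => `|pure_outcome (G i) sigma w|%R] <= C%:E)%E.
  move: (G_L1_bounded i); set A := (X in ereal_sup X).
  have ubA sigma : (forall j, stopping_times F (sigma j)) ->
      ('E_P[fun w => `|pure_outcome (G i) sigma w|%R] <= ereal_sup A)%E.
    by move=> sigmas; apply: ereal_sup_ubound; exists sigma.
  move: ubA; case: (ereal_sup A) => [C||]// ubA _; first by exists C.
  (* If the supremum is [-oo], any real bound will do. *)
  by exists 0 => sigma /ubA /le_trans; apply; rewrite leNye.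
have payoffE i sigma : (forall j, stopping_times F (sigma j)) ->
    randomized_payoff P G i (iota_embed sigma) = pure_payoff P G i sigma.
  have [C gC] := GC i.
  exact: (randomized_payoff_iota_embed F_usual (G_measurable i) gC).
have deviate_stopping i a : stopping_times F a ->
    forall j, stopping_times F (deviate tau i a j).
  by move=> sa j; rewrite /deviate; case: ifP.
have iota_deviate i a : iota_embed (deviate tau i a) =
    deviate (iota_embed tau) i (fun t w => \1_[set v | a v <= t] w).
  by apply/funext => j; rewrite /iota_embed /deviate; case: ifP.
have iota_randomized j : randomized_strategy F (iota_embed tau j).
  exact: stopping_time_randomized.
have supE i :
    ereal_sup [set randomized_payoff P G i (deviate (iota_embed tau) i q)
              | q in randomized_strategies F] =
    ereal_sup [set pure_payoff P G i (deviate tau i a)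
              | a in stopping_times F].
  have [C gC] := GC i; apply/eqP; rewrite eq_le; apply/andP; split.
  - apply: ub_ereal_sup => _ [q qs <-].
    have ps j : randomized_strategy F (deviate (iota_embed tau) i q j).
      by rewrite /deviate; case: ifP.
    apply: (randomized_payoff_le F_usual (G_measurable i) gC ps).
      (* The supremum is not [-oo], since deviating to [tau i] itself changes nothing and yields a
         finite payoff. *)
      apply: (@lt_le_trans _ _ (pure_payoff P G i tau)).
        rewrite -payoffE// ltNye_eq.
        by rewrite (randomized_payoff_fin_num F_usual (G_measurable i) gC).
      apply: ereal_sup_ubound; exists (tau i) => //; congr pure_payoff.
      by apply/funext => j; rewrite /deviate; case: eqP => // ->.
    move=> u cu; apply: ereal_sup_ubound.
    (* At a frozen [u], the deviator plays the threshold time of [q] while every opponent's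
       threshold time collapses to the original stopping time. *)
    exists ((Theta q) ^~ (tnth u i)).
      by have /andP[_ u1] := cu i; exact: Theta_stopping F_usual qs u1.
    congr ('E_P[pure_outcome _ _])%E; apply/funext => j; apply/funext => w.
    rewrite /threshold_times /deviate; case: eqP => [->//|_].
    by rewrite Theta_indic//; have [] := tau_stopping j.
  - apply: ub_ereal_sup => _ [a sa <-].
    rewrite -payoffE; last exact: deviate_stopping.
    apply: ereal_sup_ubound; rewrite iota_deviate.
    by eexists; last reflexivity; exact: stopping_time_randomized.
split=> -[_ nash]; split=> // i.
- by rewrite supE payoffE.
- by rewrite -supE -payoffE.
Qed.
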